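(* For every $k\geqslant1$, the invariant $tr_\varepsilon$ of the generalised $k$-component Hopf link $\mathbb H_k$ is $$tr_{\varepsilon}(\mathbb H_k)=(-1)^{k-1}\cdot\varepsilon^{1-k}.$$
   Context: Generalised Hopf link: $\mathbb H_k$ has a diagram $H_k$ consisting of an ordered set of $k$ trivial circles $U_1,\dots,U_k$ such that for each $i\in\{1,\dots,k-1\}$ the pair $U_i,U_{i+1}$ is linked as in the minimal (two-crossing) diagram of the classical Hopf link, and there are no other crossings (a chain; $\mathbb H_1$ is the unknot, $\mathbb H_2$ the Hopf link). Category $\mathfrak E$. Let $I=\{\mathbf 1,\mathbf A\}$. Objects are finite ordered tuples of elements of $I$, written as noncommutative sums $x_1+\dots+x_n$. A morphism $f:\sum_i x_i\to\sum_j y_j$ is a family $a_i^j\in\mathbb C$ with $a_i^j=0$ if $x_i\ne y_j$; equivalently a pair of matrices $[f]_{\mathbf 1},[f]_{\mathbf A}$ (columns: summands of the source equal to the given symbol, rows: those of the target, in order). Composition is written left to right, $[f\circ g]_S=[g]_S[f]_S$; identities have identity matrices. Tensor product: $\mathbf 1\otimes\mathbf 1=\mathbf 1$, $\mathbf 1\otimes\mathbf A=\mathbf A\otimes\mathbf 1=\mathbf A$, $\mathbf A\otimes\mathbf A=\mathbf 1+\mathbf A$, and $(\sum_i x_i)\otimes(\sum_j y_j)=\sum_i\sum_j x_i\otimes y_j$ in lexicographic order; for $f=(f_i^j)$, $g=(g_r^s)$, the entry of $f\otimes g$ from a summand of $x_i\otimes z_r$ to a summand of $y_j\otimes t_s$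 is $f_i^jg_r^s$ if $x_i=y_j$, $z_r=t_s$ and the two summands are the same summand of $x_i\otimes z_r=y_j\otimes t_s$, and $0$ otherwise. Fix $\varepsilon$ with $\varepsilon^2=\varepsilon+1$, a square root $\sqrt\varepsilon$, nonzero $x,y\in\mathbb C$, and $\beta_\varepsilon\in\{e^{3\pi i/5},e^{-3\pi i/5}\}$ if $\varepsilon>0$, $\beta_\varepsilon\in\{e^{\pi i/5},e^{-\pi i/5}\}$ if $\varepsilon<0$. Structure morphisms: $\alpha_{X,Y,Z}:(X\otimes Y)\otimes Z\to X\otimes(Y\otimes Z)$ is the identity for $X,Y,Z\in I$ not all $\mathbf A$; $[\alpha_{\mathbf A,\mathbf A,\mathbf A}]_{\mathbf 1}=(1)$, $[\alpha_{\mathbf A,\mathbf A,\mathbf A}]_{\mathbf A}=\begin{pmatrix}\frac1\varepsilon&\frac x{\sqrt\varepsilon}\\\frac1{x\sqrt\varepsilon}&-\frac1\varepsilon\end{pmatrix}$; it is extended summand-wise ($(x_i\otimes y_j)\otimes z_k\to x_i\otimes(y_j\otimes z_k)$ by $\alpha_{x_i,y_j,z_k}$). $[c_{\mathbf A,\mathbf A}]_{\mathbf 1}=(\beta_\varepsilon^2)$, $[c_{\mathbf A,\mathbf A}]_{\mathbf A}=(\beta_\varepsilon)$; $\theta_{\mathbf A}=\beta_\varepsilon^{-2}\,id_{\mathbf A}$; $b_{\mathbf A}:\mathbf 1\to\mathbf A\otimes\mathbf A$ and $d_{\mathbf A}:\mathbf A\otimes\mathbf A\to\mathbf 1$ with $[b_{\mathbf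 A}]_{\mathbf 1}=(y\sqrt\varepsilon)$, $[d_{\mathbf A}]_{\mathbf 1}=(\sqrt\varepsilon/y)$. Evaluation $\{L\}_\xi$. A colouring of a link diagram $L=l_1\cup\dots\cup l_k$ is a map $\xi:\{l_1,\dots,l_k\}\to\{\mathbf 1,\mathbf A\}$. Delete the components coloured $\mathbf 1$ to get $L'$ (if $L'$ is empty, $\{L\}_\xi=1$). Cut $L'$ by vertical lines into layers $\lambda_1,\dots,\lambda_n$ (left to right), each containing horizontal arcs and one elementary piece. Assign: positive crossing $\mapsto c_{\mathbf A,\mathbf A}$, negative crossing $\mapsto c_{\mathbf A,\mathbf A}^{-1}$ (signs computed with both strands oriented left to right); left half-circle (both ends on the right) $\mapsto b_{\mathbf A}$; right half-circle (both ends on the left) $\mapsto d_{\mathbf A}$; positive (negative) loop, i.e. an arc with one kink whose crossing is positive (negative) $\mapsto\theta_{\mathbf A}$ ($\theta_{\mathbf A}^{-1}$); horizontal arc $\mapsto id_{\mathbf A}$. Tensoring from top to bottom with any bracketing gives $\mu_{\lambda_i}$; $\{L\}_\xi\in Hom(\mathbf 1,\mathbf 1)=\mathbb C$ is $\mu_{\lambda_1}\circ\tau_1\circ\mu_{\lambda_2}\circ\dots\circ\tau_{n-1}\circ\mu_{\lambda_n}$ with $\tau_i$ the composite of associativity isomorphisms matching bracketings. Link invariant: for a link $\mathbb L$ with diagram $L=l_1\cup\dots\cup l_k$, $tr_\varepsilon(\mathbb L)=\frac{\beta_\varepsilon^{2w(L)}}{\varepsilon}\{L\}_{\xi_{\mathbf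 A}}$ (independent of the diagram), where $\xi_{\mathbf A}$ is the constant colouring with value $\mathbf A$, $w(L)=\sum_iw(l_i)$, and $w(l_i)$ is the number of positive minus the number of negative self-crossings of $l_i$. *)

(* Defs.v *)
From HB Require Import structures.
From mathcomp Require Import all_boot all_order all_algebra.
From mathcomp Require Import reals trigo.
From mathcomp Require Import complex.

Set Implicit Arguments.
Unset Strict Implicit.
Unset Printing Implicit Defensive.
Import Order.TTheory GRing.Theory Num.Theory.
Local Open Scope ring_scope.
Local Open Scope complex_scope.

Inductive sym := One | A.

Definition bool_of_sym s := if s is A then true else false.
Definition sym_of_bool b := if b then A else One.
Lemma bool_of_symK : cancel bool_of_sym sym_of_bool. Proof. by case. Qed.
HB.instance Definition _ := Equality.copy sym (can_type bool_of_symK).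

Definition tens1 (x y : sym) : seq sym :=
  match x, y with
  | One, z | z, One => [:: z]
  | A, A => [:: One; A]
  end.

(* The summands of X (x) Y in lexicographic order: (i, j, w) stands for the
   w-th summand of x_i (x) y_j; all positions are counted from 0. *)
Definition summands (X Y : seq sym) : seq (nat * nat * nat) :=
  flatten [seq [seq (i, j, w) | w <- iota 0 (size (tens1 (nth One X i) (nth One Y j)))]
          | i <- iota 0 (size X), j <- iota 0 (size Y)].

Definition tens (X Y : seq sym) : seq sym :=
  [seq nth One (tens1 (nth One X t.1.1) (nth One Y t.1.2)) t.2
  | t <- summands X Y].

(* [summands] agrees with the concatenation of the x_i (x) y_j. *)
Lemma tensE X Y : tens X Y = flatten [seq tens1 x y | x <- X, y <- Y].
Proof.
have E (x y : sym) (i j : nat) (X' Y' : seq sym) :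
    nth One X' i = x -> nth One Y' j = y ->
    [seq nth One (tens1 (nth One X' t.1.1) (nth One Y' t.1.2)) t.2
    | t <- [seq (i, j, w) | w <- iota 0 (size (tens1 (nth One X' i) (nth One Y' j)))]]
    = tens1 x y.
  by move=> <- <-; rewrite -map_comp -[RHS](mkseq_nth One).
rewrite /tens /summands map_flatten map_allpairs; congr flatten.
transitivity [seq tens1 x y | x <- mkseq (nth One X) (size X),
                              y <- mkseq (nth One Y) (size Y)].
  rewrite /mkseq allpairs_mapl allpairs_mapr.
  by apply: eq_allpairs => i j; rewrite (E _ _ _ _ X Y erefl erefl).
by rewrite !mkseq_nth.
Qed.

Section Category.
Variable R : realType.
Local Notation C := R[i].

(* [coef f i j] is the entry a_i^j from the i-th summand of X to the j-th
   summand of Y; outside the index ranges it is 0. *)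
Record hom (X Y : seq sym) := Hom {
  coef :> nat -> nat -> C;
  coef_supp : forall i j,
    ~~ [&& i < size X, j < size Y & nth One X i == nth One Y j]%N ->
    coef i j = 0
}.

(* The morphism with entries [a i j] wherever a nonzero entry is allowed. *)
Definition mkcoef (X Y : seq sym) (a : nat -> nat -> C) (i j : nat) : C :=
  if [&& i < size X, j < size Y & nth One X i == nth One Y j]%N
  then a i j else 0.

Fact mkcoef_supp X Y a i j :
  ~~ [&& i < size X, j < size Y & nth One X i == nth One Y j]%N ->
  mkcoef X Y a i j = 0.
Proof. by rewrite /mkcoef => /negbTE ->. Qed.

Definition mkhom X Y a : hom X Y := Hom (@mkcoef_supp X Y a).

(* The morphism with [f]_S = M S, a matrix given by its list of rows (rows: the
   S-summands of Y, columns: the S-summands of X). *)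
Definition of_blocks X Y (M : sym -> seq (seq C)) : hom X Y :=
  mkhom X Y (fun i j =>
    let S := nth One X i in
    nth 0 (nth [::] (M S) (count_mem S (take j Y))) (count_mem S (take i X))).

(* The entries (delta_ij); also used between tuples which are equal but not
   convertible, such as 1 (x) X and X. *)
Definition delta_hom X Y : hom X Y := mkhom X Y (fun i j => (i == j)%:R).

Definition idh X : hom X X := delta_hom X X.

Definition scaleh (a : C) X Y (f : hom X Y) : hom X Y :=
  mkhom X Y (fun i j => a * f i j).

(* Diagrammatic order: first f, then g. *)
Definition comph X Y Z (f : hom X Y) (g : hom Y Z) : hom X Z :=
  mkhom X Z (fun i j => \sum_(m < size Y) f i m * g m j).

Definition tensh X Y Z T (f : hom X Y) (g : hom Z T) :
    hom (tens X Z) (tens Y T) :=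
  mkhom (tens X Z) (tens Y T) (fun p q =>
    let: (i, r, w) := nth (0, 0, 0)%N (summands X Z) p in
    let: (j, s, v) := nth (0, 0, 0)%N (summands Y T) q in
    if [&& nth One X i == nth One Y j, nth One Z r == nth One T s & w == v]
    then f i j * g r s else 0).

Definition cis (t : R) : C := cos t +i* sin t.

Record params := Params {
  eps : R;
  eps_eq : eps ^+ 2 = eps + 1;
  sqrteps : C;
  sqrteps_eq : sqrteps ^+ 2 = eps%:C;
  px : C;
  px_neq0 : px != 0;
  py : C;
  py_neq0 : py != 0;
  beta : C;
  beta_pos : 0 < eps ->
    beta = cis (3%:R * pi / 5%:R) \/ beta = cis (- (3%:R * pi / 5%:R));
  beta_neg : eps < 0 ->
    beta = cis (pi / 5%:R) \/ beta = cis (- (pi / 5%:R))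
}.

Variable P : params.
Local Notation e := (eps P)%:C.
Local Notation r := (sqrteps P).
Local Notation x := (px P).
Local Notation y := (py P).
Local Notation b := (beta P).

Definition assoc1 (u v w : sym) :
    hom (tens (tens [:: u] [:: v]) [:: w]) (tens [:: u] (tens [:: v] [:: w])) :=
  if [&& u == A, v == A & w == A] then
    of_blocks _ _ (fun S => match S with
      | One => [:: [:: 1]]
      | A => [:: [:: 1 / e;       x / r];
                 [:: 1 / (x * r); - (1 / e)]]
      end)
  else delta_hom _ _.

(* A summand of (X (x) Y) (x) Z lies in some (x_i (x) y_j) (x) z_k, where it has
   a position of its own; likewise for X (x) (Y (x) Z). *)
Definition assoc X Y Z : hom (tens (tens X Y) Z) (tens X (tens Y Z)) :=
  mkhom (tens (tens X Y) Z) (tens X (tens Y Z)) (fun p q =>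
    let: (m, k, v) := nth (0, 0, 0)%N (summands (tens X Y) Z) p in
    let: (i, j, w) := nth (0, 0, 0)%N (summands X Y) m in
    let: (i', n, v') := nth (0, 0, 0)%N (summands X (tens Y Z)) q in
    let: (j', k', w') := nth (0, 0, 0)%N (summands Y Z) n in
    if [&& i == i', j == j' & k == k'] then
      let u1 := nth One X i in let u2 := nth One Y j in let u3 := nth One Z k in
      assoc1 u1 u2 u3
        (index (w, 0, v)%N (summands (tens [:: u1] [:: u2]) [:: u3]))
        (index (0, w', v')%N (summands [:: u1] (tens [:: u2] [:: u3])))
    else 0).

Definition AA := tens [:: A] [:: A].

Definition braid : hom AA AA :=
  of_blocks _ _ (fun S => if S is One then [:: [:: b ^+ 2]] else [:: [:: b]]).

Definition braid_inv : hom AA AA :=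
  of_blocks _ _ (fun S => if S is One then [:: [:: b ^- 2]] else [:: [:: b^-1]]).

Definition twist : hom [:: A] [:: A] := scaleh (b ^- 2) (idh [:: A]).
Definition twist_inv : hom [:: A] [:: A] := scaleh (b ^+ 2) (idh [:: A]).

Definition birth : hom [:: One] AA :=
  of_blocks _ _ (fun S => if S is One then [:: [:: y * r]] else [::]).
Definition death : hom AA [:: One] :=
  of_blocks _ _ (fun S => if S is One then [:: [:: r / y]] else [::]).

Inductive btree (T : Type) := Leaf of T | Node of btree T & btree T.

Fixpoint leaves T (t : btree T) : seq T :=
  match t with Leaf a => [:: a] | Node l m => leaves l ++ leaves m end.

Fixpoint obj (t : btree sym) : seq sym :=
  match t with Leaf a => [:: a] | Node l m => tens (obj l) (obj m) end.

(* [reassoc s t f]: f is a composite of associativity isomorphisms and their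
   inverses, tensored with identities, from the bracketing s to the bracketing t.
   The unit is strict (1 (x) X and X (x) 1 are the tuple X), which the last two
   constructors express on bracketings containing factors 1. *)
Inductive reassoc : forall s t : btree sym, hom (obj s) (obj t) -> Prop :=
| Rid t : @reassoc t t (idh (obj t))
| Rcomp s t u f g : @reassoc s t f -> @reassoc t u g -> @reassoc s u (comph f g)
| Rinv s t f g : @reassoc s t f ->
    comph f g = idh (obj s) -> comph g f = idh (obj t) -> @reassoc t s g
| Rtens s s' t t' f g : @reassoc s s' f -> @reassoc t t' g ->
    @reassoc (Node s t) (Node s' t') (tensh f g)
| Rassoc s t u :
    @reassoc (Node (Node s t) u) (Node s (Node t u)) (assoc (obj s) (obj t) (obj u))
| Runitl t : @reassoc (Node (Leaf One) t) t (delta_hom (obj (Node (Leaf One) t)) (obj t))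
| Runitr t : @reassoc (Node t (Leaf One)) t (delta_hom (obj (Node t (Leaf One))) (obj t)).

(* The boolean is the sign of the crossing, [true] for positive. *)
Inductive elem := Arc | ECross of bool | ELeft | ERight | EKink of bool.

Definition esrc (a : elem) : btree sym :=
  match a with
  | Arc | EKink _ => Leaf A
  | ECross _ | ERight => Node (Leaf A) (Leaf A)
  | ELeft => Leaf One
  end.

Definition etgt (a : elem) : btree sym :=
  match a with
  | Arc | EKink _ => Leaf A
  | ECross _ | ELeft => Node (Leaf A) (Leaf A)
  | ERight => Leaf One
  end.

Definition emor (a : elem) : hom (obj (esrc a)) (obj (etgt a)) :=
  match a return hom (obj (esrc a)) (obj (etgt a)) with
  | Arc => idh [:: A]
  | ECross s => if s then braid else braid_inv
  | ELeft => birth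
  | ERight => death
  | EKink s => if s then twist else twist_inv
  end.

Fixpoint tsrc (t : btree elem) : btree sym :=
  match t with Leaf a => esrc a | Node l m => Node (tsrc l) (tsrc m) end.

Fixpoint ttgt (t : btree elem) : btree sym :=
  match t with Leaf a => etgt a | Node l m => Node (ttgt l) (ttgt m) end.

Fixpoint mu (t : btree elem) : hom (obj (tsrc t)) (obj (ttgt t)) :=
  match t with Leaf a => emor a | Node l m => tensh (mu l) (mu m) end.

End Category.

(* A strand crossing a vertical line: the index of its link component, and
   whether an auxiliary orientation of this component traverses the strand from
   left to right. Strands are listed from top to bottom. *)
Definition strand := (nat * bool)%type.

Definition flip (a : strand) : strand := (a.1, ~~ a.2).

(* [Cross s a c]: a enters on the upper left and leaves on the lower right, c
   enters on the lower left and leaves on the upper right; s is the sign of the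
   crossing when both strands are oriented from left to right.
   [LHalf a], [RHalf a]: half-circles with upper end a and lower end [flip a]. *)
Inductive piece :=
| Cross of bool & strand & strand
| LHalf of strand
| RHalf of strand
| Kink of bool & strand.

Record layer := Layer {
  above : seq strand;
  mid : piece;
  below : seq strand
}.

Definition psrc (p : piece) : seq strand :=
  match p with
  | Cross _ a c => [:: a; c]
  | LHalf _ => [::]
  | RHalf a => [:: a; flip a]
  | Kink _ a => [:: a]
  end.

Definition ptgt (p : piece) : seq strand :=
  match p with
  | Cross _ a c => [:: c; a]
  | LHalf a => [:: a; flip a]
  | RHalf _ => [::]
  | Kink _ a => [:: a]
  end.

Definition lsrc (l : layer) := above l ++ psrc (mid l) ++ below l.
Definition ltgt (l : layer) := above l ++ ptgt (mid l) ++ below l.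

Fixpoint chained (s : seq strand) (D : seq layer) (t : seq strand) : bool :=
  if D is l :: D' then (lsrc l == s) && chained (ltgt l) D' t else s == t.

Definition relabel_strand (g : nat -> nat) (a : strand) : strand := (g a.1, a.2).
Definition relabel_piece g (p : piece) : piece :=
  match p with
  | Cross s a c => Cross s (relabel_strand g a) (relabel_strand g c)
  | LHalf a => LHalf (relabel_strand g a)
  | RHalf a => RHalf (relabel_strand g a)
  | Kink s a => Kink s (relabel_strand g a)
  end.
Definition relabel g (l : layer) : layer :=
  Layer (map (relabel_strand g) (above l)) (relabel_piece g (mid l))
        (map (relabel_strand g) (below l)).

(* [chained] makes the indices constant along each closed curve. The second
   condition says that the indexing is the finest one with this property, i.e.
   that an index is never shared by two different closed curves. *)
Definition link_diagram_axiom (D : seq layer) : Prop :=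
  chained [::] D [::] /\
  forall D', chained [::] D' [::] ->
    map (relabel (fun=> 0%N)) D' = map (relabel (fun=> 0%N)) D ->
    exists g, D' = map (relabel g) D.

Record link_diagram := LinkDiagram {
  layers :> seq layer;
  layersP : link_diagram_axiom layers
}.

Definition components (L : link_diagram) : seq nat :=
  undup [seq a.1 | a <- flatten [seq psrc (mid l) ++ ptgt (mid l) | l <- layers L]].

Definition sgn (s : bool) : int := if s then 1 else -1.

(* A crossing of antiparallel strands has the opposite of its left-to-right
   sign. The sign of a self-crossing does not depend on the orientation of the
   component. *)
Definition selfcrossing_sign (i : nat) (p : piece) : int :=
  match p with
  | Cross s a c =>
      if (a.1 == i) && (c.1 == i) then sgn (s == (a.2 == c.2)) else 0
  | Kink s a => if a.1 == i then sgn s else 0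
  | _ => 0
  end.

Definition writhe1 (L : link_diagram) (i : nat) : int :=
  \sum_(l <- layers L) selfcrossing_sign i (mid l).

Definition writhe (L : link_diagram) : int :=
  \sum_(i <- components L) writhe1 L i.

Definition colouring := nat -> sym.

(* Deleting the components coloured 1; a layer which becomes a family of
   horizontal arcs is dropped. *)
Definition keep (xi : colouring) (a : strand) : bool := xi a.1 == A.

Definition keep_piece xi (p : piece) : bool :=
  match p with
  | Cross _ a c => keep xi a && keep xi c
  | LHalf a | RHalf a | Kink _ a => keep xi a
  end.

Definition delete (xi : colouring) (D : seq layer) : seq layer :=
  [seq Layer [seq a <- above l | keep xi a] (mid l) [seq a <- below l | keep xi a]
  | l <- D & keep_piece xi (mid l)].

Definition piece_elem (p : piece) : elem :=
  match p with
  | Cross s _ _ => ECross s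
  | LHalf _ => ELeft
  | RHalf _ => ERight
  | Kink s _ => EKink s
  end.

Definition factors (l : layer) : seq elem :=
  nseq (size (above l)) Arc ++ piece_elem (mid l) :: nseq (size (below l)) Arc.

Section Evaluation.
Variables (R : realType) (P : params R).

(* [composite D s t f]: f = mu_1 o tau_1 o mu_2 o ... o mu_n for some choice of
   bracketings of the layers of D. *)
Inductive composite :
  seq layer -> forall s t : btree sym, hom R (obj s) (obj t) -> Prop :=
| Clast l T : leaves T = factors l ->
    @composite [:: l] (tsrc T) (ttgt T) (mu P T)
| Ccons l T D s t tau f : leaves T = factors l ->
    reassoc P tau -> @composite D s t f ->
    @composite (l :: D) (tsrc T) t
      (comph (comph (mu P T) (tau : hom R (obj (ttgt T)) (obj s))) f).

(* [evaluates L xi v]: v is a value of {L}_xi, for some choice of bracketings. *)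
Definition evaluates (L : link_diagram) (xi : colouring) (v : R[i]) : Prop :=
  if delete xi L is [::] then v = 1
  else exists f : hom R (obj (Leaf One)) (obj (Leaf One)),
         @composite (delete xi L) (Leaf One) (Leaf One) f /\ v = f 0%N 0%N.

(* [is_tr L v]: v is a value of tr_epsilon computed from the diagram L. *)
Definition is_tr (L : link_diagram) (v : R[i]) : Prop :=
  exists2 z, evaluates L (fun=> A) z
           & v = beta P ^ (2 * writhe L) / (eps P)%:C * z.

End Evaluation.

(* The circle U_i.+1 opens inside U_i; their upper arcs cross, their lower arcs
   cross, and U_i closes inside U_i.+1. The upper arc of each circle is oriented
   from left to right. The two circles are linked when the same arc (the one
   descending from left to right, or the ascending one) passes over at both
   crossings, i.e. when the two left-to-right signs agree; the two possible signs
   give the two minimal diagrams of the Hopf link. *)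
Definition clasp (s : bool) (i : nat) : seq layer :=
  [:: Layer [:: (i, true)] (LHalf (i.+1, true)) [:: (i, false)];
      Layer [::] (Cross s (i, true) (i.+1, true)) [:: (i.+1, false); (i, false)];
      Layer [:: (i.+1, true); (i, true)] (Cross s (i.+1, false) (i, false)) [::];
      Layer [:: (i.+1, true)] (RHalf (i, true)) [:: (i.+1, false)]].

(* The circles are indexed by 0, ..., k-1; [s i] is the sign chosen for the clasp
   of the circles i and i.+1. *)
Definition hopf_layers (k : nat) (s : nat -> bool) : seq layer :=
  if k is n.+1 then
    Layer [::] (LHalf (0%N, true)) [::]
    :: flatten [seq clasp (s i) i | i <- iota 0 n]
    ++ [:: Layer [::] (RHalf (n, true)) [::]]
  else [::].

Lemma hopf_chained k s : chained [::] (hopf_layers k s) [::].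
Proof.
case: k => //= n.
suff H m i : chained [:: (i, true); (i, false)]
    (flatten [seq clasp (s j) j | j <- iota i m]
     ++ [:: Layer [::] (RHalf ((i + m)%N, true)) [::]]) [::] by exact: (H n 0%N).
elim: m i => [|m IH] i /=; first by rewrite addn0 /lsrc /= /flip /= !eqxx.
by rewrite /lsrc /ltgt /= /flip /= !eqxx /= addnS -addSn IH.
Qed.

Lemma hopf_finest n s (i a : nat) (D' : seq layer) :
  chained [:: (a, true); (a, false)] D' [::] ->
  map (relabel (fun=> 0%N)) D'
    = map (relabel (fun=> 0%N))
        (flatten [seq clasp (s j) j | j <- iota i n]
         ++ [:: Layer [::] (RHalf ((i + n)%N, true)) [::]]) ->
  exists g, g i = a /\
    forall h, (forall j, (i <= j)%N -> h j = g j) ->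
      D' = map (relabel h)
        (flatten [seq clasp (s j) j | j <- iota i n]
         ++ [:: Layer [::] (RHalf ((i + n)%N, true)) [::]]).
Proof.
elim: n i a D' => [|n IH] i a D' /=.
  case: D' => [|[u [sg p q|p|p|sg p] v] [|l D']] //=; rewrite /lsrc /ltgt /=.
  case: u => //; case: v => //; case: p => p d /=.
  rewrite /flip /= => /andP[/eqP[-> ->] _] _.
  exists (fun=> a); split=> // h hE.
  by rewrite addn0 /relabel /= /relabel_strand /= hE.
case: D' => [|l1 [|l2 [|l3 [|l4 D']]]] //= H E.
case: E => E11 E12 E13 E21 E22 E23 E31 E32 E33 E41 E42 E43 ED.
case/and5P: H => /eqP H1 /eqP H2 /eqP H3 /eqP H4 H5.
case: l1 E11 E12 E13 H1 H2 => [[|u1 [|? ?]] [//|[c d]|//|//] v1] //= _ [Ed] _.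
rewrite /lsrc /ltgt /= {d}Ed => -[-> ->] /=; rewrite /flip /=.
case: l2 E21 E22 E23 H3 => [[|? ?] [sg p q|//|//|//] v2] //= _ [-> _ _] _.
rewrite /ltgt /= => /[swap] -[-> -> ->] /=.
case: l3 E31 E32 E33 H4 => [[|u3 [|u4 [|? ?]]] [sg' p3 q3|//|//|//] [|? ?]] //= _ [-> _ _] _.
rewrite /ltgt /= => /[swap] -[-> -> -> ->] /=.
case: l4 E41 E42 E43 H5 => [[|u5 [|? ?]] [//|//|p4|//] [|v5 [|? ?]]] //= _ _ _.
rewrite /ltgt /= => /[swap] -[-> -> _ _ ->] /= H5.
move: ED; rewrite addnS -addSn => /(IH _ _ _ H5)[g [gi gE]].
exists (fun j => if j == i then a else g j); split=> [|h hE]; first by rewrite eqxx.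
have hi : h i = a by rewrite hE // eqxx.
have hS j : (i < j)%N -> h j = g j by move=> ij; rewrite hE ?(ltnW ij) // gtn_eqF.
by rewrite -(gE h hS) /relabel /= /relabel_strand /= hi hS // gi.
Qed.

Lemma hopf_link_diagram k s : link_diagram_axiom (hopf_layers k s).
Proof.
split=> [|D']; first exact: hopf_chained.
case: k => [|n] /=; first by case: D' => // _ _; exists id.
case: D' => [|l D'] //= /andP[/eqP H HD] [E1 E2 E3 ED].
case: l E1 E2 E3 H HD => [[|? ?] [//|[c d]|//|//] [|? ?]] //= _ [->] _ _ HD.
have [g [g0 gE]] := hopf_finest (i := 0%N) HD ED.
by exists g; rewrite -(gE g) // /relabel /= /relabel_strand /= g0.
Qed.

Definition hopf_chain (k : nat) (s : nat -> bool) : link_diagram :=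
  LinkDiagram (hopf_link_diagram k s).

(* Main.v *)
Require Import Defs.
From mathcomp Require Import all_boot all_order all_algebra.
From mathcomp Require Import reals trigo boolp.
From mathcomp Require Import complex ring lra.
Import Order.TTheory GRing.Theory Num.Theory.
Set Implicit Arguments.
Unset Strict Implicit.
Unset Printing Implicit Defensive.
Local Open Scope ring_scope.
Local Open Scope complex_scope.

(** Everything is expressed in one basis that does not depend on bracketings.
    For a bracketing [t] with n factors [A] and a symbol a, the tuple
    [obj t] (x) a is isomorphic to the right-nested product
    A (x) (A (x) ... (A (x) a)), whose summands are the admissible paths
    p = [:: x_0; x_1; ...; x_n] with x_n = a and each x_k a summand of
    A (x) x_(k+1); the head x_0 is the total symbol. The entry of this
    isomorphism from the i-th summand of [obj t] to the path p is
    [path_coef t i p], a product of entries of alpha, one for each node of [t].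

    Coherence ([reassoc_path_coef]): a reassociation s -> t carries the path
    basis of t to that of s. This is proved by induction on the reassociation,
    the associativity isomorphism itself being the pentagon equation
    ([sixj_pentagon]), a finite list of identities between entries of alpha.

    Hence, read in the path basis, the morphism of a layer depends only on the
    list of its factors ([mu_path_coef]), and a composite morphism 1 -> 1 equals
    a number computed from the layers alone, whatever the bracketings
    ([composite_value]). That is the uniqueness half of the theorem; for the
    other half, [hopf_composite] exhibits bracketings.

    Between two clasps of the chain only two strands cross a vertical line, and
    their total symbol is 1, so the only path is [:: One; A; One] and each clasp
    acts by a scalar. The two crossings of the clasp contribute t^4 or t^2
    according to the symbol between the two middle strands, where t is beta or
    its inverse, and the half-circles weigh these by the entries of alpha; the
    scalar is t^4 / eps + t^2 = - 1 / eps ([clasp_value]), because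
    beta + 1 / beta = 1 - eps ([beta_quadratic]). The outer half-circles give
    (y sqrt eps) (sqrt eps / y) = eps, cancelled by the normalisation, and the
    writhe vanishes since every crossing is between two different circles. *)

(** * The pentagon equation *)

(** Whether [c] is a summand of the product of [a] and [b]; written as a table
    because the finite case analyses below evaluate it very often. *)
Definition fusion (a b c : sym) : bool :=
  match a, b, c with
  | One, One, A | One, A, One | A, One, One => false
  | _, _, _ => true
  end.

Section SixJ.
Variables (K : comNzRingType) (p q s : K).

(** The entry of (a b) c -> a (b c) in total symbol [d], from the summand whose
    a b part is [u] to the one whose b c part is [v]. The parameters [p], [q] and
    [s] stand for 1 / eps, 1 / (x sqrt eps) and x / sqrt eps. *)
Definition sixj (a b c d u v : sym) : K :=
  if [&& fusion a b u, fusion u c d, fusion b c v & fusion a v d] then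
    match a, b, c, d with
    | A, A, A, A =>
      match u, v with
      | One, One => p | One, A => q | A, One => s | A, A => - p
      end
    | _, _, _, _ => 1
    end
  else 0.

Hypotheses (pp : p * p = 1 - p) (qs : q * s = p).

(** Both sides are entries of maps ((a b) c) d -> a (b (c d)); the sum runs over
    the symbol of b c in the route through (a (b c)) d. Given
    [q * s = p], the first hypothesis says that the block of alpha is an
    involution. *)
Lemma sixj_pentagon a b c d e u w v t :
  sixj a b c w u One * sixj a One d e w v * sixj b c d v One t +
  sixj a b c w u A * sixj a A d e w v * sixj b c d v A t =
  sixj u c d e w t * sixj a b t e u v.
Proof.
case: a; case: b; case: c; case: d; case: u; case: w; case: t; case: v; case: e;
  rewrite /sixj /=; ring: pp qs.
Qed.
End SixJ.

(** * Sums over the summands of a tensor product *)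

Local Notation "0t" := (0, 0, 0)%N (only parsing).

Lemma size_tens X Y : size (tens X Y) = size (summands X Y).
Proof. by rewrite size_map. Qed.

Lemma nth_tens X Y m : (m < size (tens X Y))%N ->
  let t := nth 0t (summands X Y) m in
  [/\ t.1.1 < size X, t.1.2 < size Y,
      t.2 < size (tens1 (nth One X t.1.1) (nth One Y t.1.2))
    & nth One (tens X Y) m =
      nth One (tens1 (nth One X t.1.1) (nth One Y t.1.2)) t.2]%N.
Proof.
rewrite size_tens => lm t; have : t \in summands X Y by exact: mem_nth.
case/flattenP => _ /allpairsP[[i j] /= [iX jY ->]] /mapP[w wS tE].
move: iX jY wS; rewrite !mem_iota !add0n => /andP[_ ?] /andP[_ ?] /andP[_ ?].
by split; rewrite /tens ?(nth_map 0t) // -/t ?tE.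
Qed.

(** This is what makes positions in a tensor product disappear from all later
    computations: sums over them become sums over triples. *)
Lemma sum_tens (V : nmodType) X Y (G : nat * nat * nat -> V) :
  \sum_(m < size (tens X Y)) G (nth 0t (summands X Y) m) =
  \sum_(i < size X) \sum_(j < size Y)
    \sum_(w < size (tens1 (nth One X i) (nth One Y j))) G (i : nat, j : nat, w : nat).
Proof.
have iotaE n : iota 0 n = index_iota 0 n by rewrite /index_iota subn0.
rewrite size_tens -(big_mkord xpredT (fun m => G (nth 0t (summands X Y) m))).
rewrite -(big_nth 0t xpredT G) big_flatten /= big_allpairs_dep iotaE big_mkord.
apply: eq_bigr => i _; rewrite iotaE big_mkord; apply: eq_bigr => j _.
by rewrite big_map iotaE big_mkord.
Qed.

(** * The path basis *)

Section Paths.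
Variables (R : realType) (P : params R).
Local Notation C := R[i].
Local Notation hom := (Defs.hom R).
Local Notation e := (eps P)%:C.
Local Notation r := (sqrteps P).
Local Notation x := (px P).
Local Notation y := (py P).
Local Notation b := (beta P).

Lemma eps_sqr : e * e = e + 1.
Proof. by rewrite -rmorphM /= -expr2 eps_eq rmorphD. Qed.

Lemma eps_neq0 : e != 0.
Proof.
by apply/eqP => e0; move/eqP: eps_sqr; rewrite e0 mul0r add0r eq_sym oner_eq0.
Qed.

Lemma sqrteps_sqr : r * r = e.
Proof. by rewrite -expr2 sqrteps_eq. Qed.

Lemma sqrteps_neq0 : r != 0.
Proof.
by apply/eqP => r0; move: eps_neq0; rewrite -sqrteps_sqr r0 mul0r eqxx.
Qed.

Definition fsym := sixj (1 / e) (1 / (x * r)) (x / r).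

(** The entries of the inverse of alpha. As the [A]-block of alpha is an
    involution, exchanging its off-diagonal entries transposes it, which allows
    the inverse to be written with [u] and [v] in their original slots. *)
Definition fsym_inv (a b c d v u : sym) := sixj (1 / e) (x / r) (1 / (x * r)) a b c d u v.

(** This is eps^2 = eps + 1 for the inverse of eps. *)
Lemma fsym_diag_sqr : 1 / e * (1 / e) = 1 - 1 / e.
Proof.
have e0 := eps_neq0.
transitivity ((e * e - e) / (e * e)); last by field.
by rewrite {1}eps_sqr addrAC subrr add0r; field.
Qed.

Lemma fsym_offdiag : 1 / (x * r) * (x / r) = 1 / e.
Proof.
have x0 := px_neq0 P; have r0 := sqrteps_neq0.
by rewrite -sqrteps_sqr; field; rewrite x0 r0.
Qed.

Lemma assoc1E a1 a2 a3 w v w' v' :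
    let u := nth One (tens1 a1 a2) w in let u' := nth One (tens1 a2 a3) w' in
    (w < size (tens1 a1 a2))%N -> (v < size (tens1 u a3))%N ->
    (w' < size (tens1 a2 a3))%N -> (v' < size (tens1 a1 u'))%N ->
  assoc1 P a1 a2 a3
    (index (w, 0, v)%N (summands (tens [:: a1] [:: a2]) [:: a3]))
    (index (0, w', v')%N (summands [:: a1] (tens [:: a2] [:: a3]))) =
  if nth One (tens1 u a3) v == nth One (tens1 a1 u') v'
  then fsym a1 a2 a3 (nth One (tens1 u a3) v) u u' else 0.
Proof.
case: a1; case: a2; case: a3; case: w => [|[|w]] //; case: w' => [|[|w']] //;
case: v => [|[|v]] //; case: v' => [|[|v']] // _ _ _ _.
all: rewrite /fsym /sixj /assoc1 /= /mkcoef /=.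
all: reflexivity.
Qed.

(** A morphism [tensh f g] only links summands with equal third component, so
    that component passes through unchanged. *)
Lemma tensh_sum X Y Z T (f : hom X Y) (g : hom Z T) m
    (G : nat * nat * nat -> C) : (m < size (tens X Z))%N ->
  let t := nth 0t (summands X Z) m in
  \sum_(n < size (tens Y T)) tensh f g m n * G (nth 0t (summands Y T) n) =
  \sum_(j < size Y) \sum_(l < size T) f t.1.1 j * g t.1.2 l * G (j : nat, l : nat, t.2).
Proof.
move=> lm t.
pose H (t' : nat * nat * nat) :=
  if [&& nth One X t.1.1 == nth One Y t'.1.1,
         nth One Z t.1.2 == nth One T t'.1.2 & t.2 == t'.2]
  then f t.1.1 t'.1.1 * g t.1.2 t'.1.2 else 0.
have [iX kZ wS mE] := nth_tens lm; rewrite -/t in iX kZ wS mE.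
under eq_bigr => n _.
  suff -> : tensh f g m n = H (nth 0t (summands Y T) n) by over.
  rewrite /= /mkcoef lm ltn_ord /= mE.
  have [_ _ _ ->] := nth_tens (ltn_ord n); rewrite -/t /H.
  clear H iX kZ wS mE; case: (nth 0t (summands Y T) n) t => [[j l] v] [[i k] w] /=.
  case: (altP (nth One X i =P _)) => [->|]; last by rewrite if_same.
  case: (altP (nth One Z k =P _)) => [->|]; last by rewrite if_same.
  by case: (altP (w =P v)) => [->|]; rewrite ?eqxx ?if_same.
rewrite (sum_tens _ _ (fun t' => H t' * G t')).
apply: eq_bigr => j _; apply: eq_bigr => l _; rewrite /H /=.
case: (eqVneq (nth One X _) _) => [xE|xN] /=; last first.
  rewrite (coef_supp f) ?(negbTE xN) ?andbF // !mul0r.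
  by rewrite big1 // => w _; rewrite mul0r.
case: (eqVneq (nth One Z _) _) => [zE|zN] /=; last first.
  rewrite (coef_supp g) ?(negbTE zN) ?andbF // mulr0 !mul0r.
  by rewrite big1 // => w _; rewrite mul0r.
rewrite -xE -zE (bigD1 (Ordinal wS)) //= eqxx big1 ?addr0 // => w.
by rewrite -val_eqE /= eq_sym => /negbTE ->; rewrite mul0r.
Qed.

Fixpoint nstrands (t : btree sym) : nat :=
  match t with
  | Leaf One => 0
  | Leaf A => 1
  | Node l m => nstrands l + nstrands m
  end.

(** Position 0 of the path [p] is the total symbol and position [nstrands t] the
    symbol tensored on the right of [t]. At a node the right factor [m] uses the
    tail of the path, and its total symbol, at position [nstrands l], is what the
    left factor [l] is tensored with. Later positions are ignored
    ([path_coef_local]), so that a path may carry strands below those of [t]. *)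
Fixpoint path_coef (t : btree sym) (i : nat) (p : seq sym) : C :=
  match t with
  | Leaf One => 1
  | Leaf A => (fusion A (nth One p 1) (nth One p 0))%:R
  | Node l m =>
    let n := nth 0t (summands (obj l) (obj m)) i in
    let u := nth One (obj l) n.1.1 in
    let v := nth One (obj m) n.1.2 in
    fsym u v (nth One p (nstrands l + nstrands m)) (nth One p 0)
      (nth One (tens1 u v) n.2) (nth One p (nstrands l))
    * path_coef l n.1.1 p * path_coef m n.1.2 (drop (nstrands l) p)
  end.

Lemma sixj_fusion (K : comNzRingType) (p q s : K) a b c d u v :
  sixj p q s a b c d u v =
  [&& fusion a b u, fusion u c d, fusion b c v & fusion a v d]%:R
  * sixj p q s a b c d u v.
Proof. by rewrite /sixj; case: ifP => _; rewrite ?mul1r ?mulr0. Qed.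

Lemma path_coef_fusion t i p : (i < size (obj t))%N ->
  path_coef t i p =
  (fusion (nth One (obj t) i) (nth One p (nstrands t)) (nth One p 0))%:R
  * path_coef t i p.
Proof.
case: t => [[|]|l m] /=.
- by case: i => //= _; case: (nth One p 0); rewrite mulr1.
- by case: i => //= _; case: (nth One p 1); case: (nth One p 0); rewrite /= ?mulr1 ?mulr0.
move/nth_tens => [_ _ _ ->].
rewrite /fsym [sixj _ _ _ _ _ _ _ _ _]sixj_fusion.
set s := sixj _ _ _ _ _ _ _ _ _.
by case: (fusion _ _ (nth One p 0)); rewrite ?mul1r // !andbF !mul0r.
Qed.

Lemma tens1r (u : sym) : tens1 u One = [:: u].
Proof. by case: u. Qed.

Lemma summands_unitl X : summands [:: One] X = [seq (0, j, 0)%N | j <- iota 0 (size X)].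
Proof.
rewrite /summands /= cats0.
by elim: (iota 0 (size X)) => //= j l ->.
Qed.

Lemma summands_unitr X : summands X [:: One] = [seq (i, 0, 0)%N | i <- iota 0 (size X)].
Proof.
rewrite /summands /=.
by elim: (iota 0 (size X)) => //= j l; rewrite tens1r => ->.
Qed.

Lemma tens_unitl X : tens [:: One] X = X.
Proof. by rewrite /tens summands_unitl -map_comp -[RHS](mkseq_nth One). Qed.

Lemma tens_unitr X : tens X [:: One] = X.
Proof.
rewrite /tens summands_unitr -map_comp -[RHS](mkseq_nth One).
by apply: eq_map => i /=; rewrite tens1r.
Qed.

Lemma delta_hom_sum X Y i (h : nat -> C) : X = Y -> (i < size X)%N ->
  \sum_(j < size Y) delta_hom R X Y i j * h j = h i.
Proof.
move=> -> iY; rewrite (bigD1 (Ordinal iY)) //= /mkcoef iY !eqxx mul1r.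
rewrite big1 ?addr0 // => j; rewrite -val_eqE /= eq_sym => /negbTE ->.
by rewrite if_same mul0r.
Qed.

Lemma fsym_unitl v a c : fsym One v a c v c = (fusion v a c)%:R.
Proof. by case: v; case: a; case: c. Qed.

Lemma fsym_unitr v a c : fsym v One a c v a = (fusion v a c)%:R.
Proof. by case: v; case: a; case: c. Qed.

Lemma sum_tens1 (V : pzRingType) a c (h : sym -> V) :
  \sum_(w < size (tens1 a c)) h (nth One (tens1 a c) w) =
  (fusion a c One)%:R * h One + (fusion a c A)%:R * h A.
Proof.
by case: a; case: c;
  rewrite /= !big_ord_recl big_ord0 /= ?mul1r ?mul0r ?addr0 ?add0r.
Qed.

(** The entry of [assoc] between two triples vanishes unless they lie over the
    same x_i, y_j, z_k and have the same symbol [d]. What remains is a sum over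
    the position [w'] of the symbol of y_j (x) z_k; the position inside
    x_i (x) (y_j (x) z_k) is then determined by [d], as products of two symbols
    are multiplicity free. *)
Lemma assoc_sum X Y Z m m0 i j k w v (G : nat -> nat * nat * nat -> sym -> C) :
  (m < size (tens (tens X Y) Z))%N ->
  nth 0t (summands (tens X Y) Z) m = (m0, k, v) ->
  nth 0t (summands X Y) m0 = (i, j, w) ->
  let x1 := nth One X i in let x2 := nth One Y j in let x3 := nth One Z k in
  let u := nth One (tens1 x1 x2) w in let d := nth One (tens1 u x3) v in
  \sum_(n < size (tens X (tens Y Z))) assoc P X Y Z m n *
    (let n1 := nth 0t (summands X (tens Y Z)) n in
     G n1.1.1 (nth 0t (summands Y Z) n1.1.2)
       (nth One (tens1 (nth One X n1.1.1) (nth One (tens Y Z) n1.1.2)) n1.2)) =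
  \sum_(w' < size (tens1 x2 x3))
    fsym x1 x2 x3 d u (nth One (tens1 x2 x3) w') * G i (j, k, w' : nat) d.
Proof.
move=> lm tE t'E x1 x2 x3 u d.
have := nth_tens lm; rewrite tE => -[mXY kZ vS mE].
have := nth_tens mXY; rewrite t'E => -[iX jY wS uE].
rewrite /= in mXY kZ vS mE iX jY wS uE.
rewrite uE -/x1 -/x2 -/x3 -/u -/d in vS mE.
pose f (w' : nat) := nth One (tens1 x2 x3) w'.
(* The entries of assoc as a function of the target triple and its symbol. *)
pose H (i' : nat) (n2 : nat * nat * nat) (d' : sym) :=
  if [&& i == i', j == n2.1.1, k == n2.1.2 & d == d']
  then fsym x1 x2 x3 d u (f n2.2) else 0.
under eq_bigr => n _.
  suff -> : assoc P X Y Z m n =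
    let n1 := nth 0t (summands X (tens Y Z)) n in
    H n1.1.1 (nth 0t (summands Y Z) n1.1.2)
       (nth One (tens1 (nth One X n1.1.1) (nth One (tens Y Z) n1.1.2)) n1.2).
    over.
  rewrite /= /mkcoef lm ltn_ord /= mE tE t'E.
  have [i'X nYZ v'S ->] := nth_tens (ltn_ord n).
  have [j'Y k'Z w'S u'E] := nth_tens nYZ.
  move: u'E w'S v'S; rewrite /H.
  case: (nth 0t (summands X _) n) {i'X nYZ j'Y k'Z} => [[i' n'] v'] /=.
  case: (nth 0t (summands Y Z) n') => [[j' k'] w'] /= -> w'S.
  case: (eqVneq i i') => [<-|] /=; last by rewrite if_same.
  case: (eqVneq j j') w'S => [<-|] /=; last by rewrite if_same.
  case: (eqVneq k k') => [<-|] /=; last by rewrite if_same.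
  rewrite -/x1 -/x2 -/x3 => w'S v'S.
  by rewrite assoc1E // -/u -/d; case: (d == _).
rewrite (sum_tens _ _ (fun n1 =>
  H n1.1.1 (nth 0t (summands Y Z) n1.1.2)
   (nth One (tens1 (nth One X n1.1.1) (nth One (tens Y Z) n1.1.2)) n1.2) *
  G n1.1.1 (nth 0t (summands Y Z) n1.1.2)
   (nth One (tens1 (nth One X n1.1.1) (nth One (tens Y Z) n1.1.2)) n1.2))).
rewrite (bigD1 (Ordinal iX)) //= [X in _ + X]big1 ?addr0; last first.
  move=> i'; rewrite -val_eqE /= eq_sym => /negbTE iN.
  by rewrite big1 // => n _; rewrite big1 // => v' _; rewrite /H iN mul0r.
(* The inner sum depends on the summand n only through its triple n2, which
   allows the sum over n to be split in turn. *)
pose K (n2 : nat * nat * nat) :=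
  \sum_(v < size (tens1 x1 (nth One (tens1 (nth One Y n2.1.1) (nth One Z n2.1.2)) n2.2)))
    let d' := nth One (tens1 x1
      (nth One (tens1 (nth One Y n2.1.1) (nth One Z n2.1.2)) n2.2)) v in
    H i n2 d' * G i n2 d'.
under eq_bigr => n _.
  have [_ _ _ ->] := nth_tens (ltn_ord n).
  rewrite -/(K (nth 0t (summands Y Z) n)); over.
rewrite (sum_tens _ _ K) (bigD1 (Ordinal jY)) //= [X in _ + X]big1 ?addr0; last first.
  move=> j'; rewrite -val_eqE /= eq_sym => /negbTE jN.
  rewrite big1 // => n _; rewrite big1 // => v1 _; rewrite /K big1 // => v' _.
  by rewrite /H jN /= andbF mul0r.
rewrite (bigD1 (Ordinal kZ)) //= [X in _ + X]big1 ?addr0; last first.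
  move=> k'; rewrite -val_eqE /= eq_sym => /negbTE kN.
  rewrite big1 // => n _; rewrite /K big1 // => v' _.
  by rewrite /H kN /= !andbF mul0r.
apply: eq_bigr => w' _; rewrite /K /= (sum_tens1 _ _ (fun d' => H _ _ d' * G _ _ d')).
rewrite /H /= !eqxx /= -/x2 -/x3 -/(f w') /fsym (sixj_fusion _ _ _ _ _ _ d).
rewrite -/x1.
by case: (d) => /=; [case: (fusion x1 (f w') One) | case: (fusion x1 (f w') A)];
  rewrite ?andbF ?(mul1r, mul0r, mulr0, addr0, add0r).
Qed.

Lemma comphE X Y Z (f : hom X Y) (g : hom Y Z) i j :
  comph f g i j = \sum_(m < size Y) f i m * g m j.
Proof.
rewrite /= /mkcoef; case: ifP => // ijN; rewrite big1 // => m _.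
case: (boolP [&& i < size X, m < size Y & nth One X i == nth One Y m])%N; last first.
  by move/(coef_supp f) ->; rewrite mul0r.
case/and3P => iX mY /eqP imE; rewrite (coef_supp g) ?mulr0 //.
by move: ijN; rewrite iX mY -imE /= => ->.
Qed.

Lemma comph_sum X Y Z (f : hom X Y) (g : hom Y Z) i (h : nat -> C) :
  \sum_(k < size Z) comph f g i k * h k =
  \sum_(j < size Y) f i j * \sum_(k < size Z) g j k * h k.
Proof.
under eq_bigr => k _ do rewrite comphE mulr_suml.
rewrite exchange_big /=; apply: eq_bigr => j _; rewrite mulr_sumr.
by apply: eq_bigr => k _; rewrite mulrA.
Qed.

(** The 6j-symbol at the node of the target involves the same symbols as that of
    the source, because [f] and [g] preserve symbols; it factors out. *)
Lemma tensh_path_coef s s' t t' (f : hom (obj s) (obj s')) (g : hom (obj t) (obj t'))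
    m p (n := nth 0t (summands (obj s) (obj t)) m) :
  (m < size (obj (Node s t)))%N ->
  \sum_(k < size (obj (Node s' t'))) tensh f g m k * path_coef (Node s' t') k p =
  let u := nth One (obj s) n.1.1 in
  let v := nth One (obj t) n.1.2 in
  fsym u v (nth One p (nstrands s' + nstrands t')) (nth One p 0)
    (nth One (tens1 u v) n.2) (nth One p (nstrands s')) *
  (\sum_(j < size (obj s')) f n.1.1 j * path_coef s' j p) *
  (\sum_(j < size (obj t')) g n.1.2 j * path_coef t' j (drop (nstrands s') p)).
Proof.
move=> lm; rewrite /= (tensh_sum f g (fun n => let u := nth One (obj s') n.1.1 in
    let v := nth One (obj t') n.1.2 in
    fsym u v (nth One p (nstrands s' + nstrands t')) (nth One p 0)
      (nth One (tens1 u v) n.2) (nth One p (nstrands s'))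
    * path_coef s' n.1.1 p * path_coef t' n.1.2 (drop (nstrands s') p))) //= -/n.
rewrite -mulrA mulr_suml mulr_sumr.
apply: eq_bigr => j _; rewrite mulr_sumr mulr_sumr; apply: eq_bigr => k _ /=.
case: (eqVneq (nth One (obj s) n.1.1) (nth One (obj s') j)) => [->|fN]; last first.
  by rewrite (coef_supp f) ?(negbTE fN) ?andbF // !(mul0r, mulr0).
case: (eqVneq (nth One (obj t) n.1.2) (nth One (obj t') k)) => [->|gN]; last first.
  by rewrite (coef_supp g) ?(negbTE gN) ?andbF // !(mul0r, mulr0).
by ring.
Qed.

(** After the products of path coefficients of the three factors are taken out,
    this is the pentagon equation for x_i, y_j, z_k and the symbol on their
    right. *)
Lemma assoc_path_coef s t u m p : (m < size (obj (Node (Node s t) u)))%N ->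
  \sum_(k < size (obj (Node s (Node t u))))
    assoc P (obj s) (obj t) (obj u) m k * path_coef (Node s (Node t u)) k p =
  path_coef (Node (Node s t) u) m p.
Proof.
move=> lm.
case tE: (nth 0t (summands (tens (obj s) (obj t)) (obj u)) m) => [[m0 k] v].
case t'E: (nth 0t (summands (obj s) (obj t)) m0) => [[i j] w].
have := nth_tens lm; rewrite tE => -[mst _ _ _].
have := nth_tens mst; rewrite t'E => -[_ _ _ zE].
rewrite /= in zE.
pose G i (n2 : nat * nat * nat) d :=
  let y1 := nth One (obj t) n2.1.1 in let y2 := nth One (obj u) n2.1.2 in
  let z := nth One (tens1 y1 y2) n2.2 in
  fsym (nth One (obj s) i) z (nth One p (nstrands s + (nstrands t + nstrands u)))
    (nth One p 0) d (nth One p (nstrands s)) * path_coef s i p *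
  (fsym y1 y2 (nth One p (nstrands s + (nstrands t + nstrands u)))
    (nth One p (nstrands s)) z (nth One p (nstrands s + nstrands t))
   * path_coef t n2.1.1 (drop (nstrands s) p)
   * path_coef u n2.1.2 (drop (nstrands s + nstrands t) p)).
rewrite (eq_bigr (fun k : 'I__ => assoc P (obj s) (obj t) (obj u) m k *
    (let n1 := nth 0t (summands (obj s) (tens (obj t) (obj u))) k in
     G n1.1.1 (nth 0t (summands (obj t) (obj u)) n1.1.2)
       (nth One (tens1 (nth One (obj s) n1.1.1)
                       (nth One (tens (obj t) (obj u)) n1.1.2)) n1.2)))); last first.
  move=> n _; congr (_ * _); rewrite [LHS]/= /G.
  have [_ nS _ _] := nth_tens (ltn_ord n).
  have [_ _ _ ->] := nth_tens nS.
  by rewrite !nth_drop drop_drop addn0 [(nstrands t + nstrands s)%N]addnC.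
rewrite (assoc_sum G lm tE t'E) /G [RHS]/= tE t'E /= zE.
set x1 := nth One (obj s) i; set x2 := nth One (obj t) j; set x3 := nth One (obj u) k.
set z := nth One (tens1 x1 x2) w; set d := nth One (tens1 z x3) v.
set b1 := nth One p (nstrands s + nstrands t); set b2 := nth One p (nstrands s).
rewrite !addnA; set a := nth One p (nstrands s + nstrands t + nstrands u).
set c := nth One p 0.
set q1 := path_coef s i p; set q2 := path_coef t j _; set q3 := path_coef u k _.
have absorb z' : fsym x2 x3 a b2 z' b1 = (fusion x2 x3 z')%:R * fsym x2 x3 a b2 z' b1.
  by rewrite /fsym /sixj; case: (fusion x2 x3 z'); rewrite ?mul1r ?mul0r.
rewrite (sum_tens1 x2 x3 (fun z' => fsym x1 x2 x3 d z z' *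
  (fsym x1 z' a c d b2 * q1 * (fsym x2 x3 a b2 z' b1 * q2 * q3)))).
transitivity (fsym z x3 a c d b1 * fsym x1 x2 b1 c z b2 * (q1 * q2 * q3)); last by ring.
rewrite -(sixj_pentagon fsym_diag_sqr fsym_offdiag) -/fsym mulrDl.
by congr (_ + _); rewrite [in RHS]absorb; ring.
Qed.

(** Coherence. As the matrices of path coefficients are invertible, this forces
    all reassociations s -> t to coincide. *)
Lemma reassoc_path_coef s t (f : hom (obj s) (obj t)) : reassoc P f ->
  nstrands s = nstrands t /\ forall i p, (i < size (obj s))%N ->
  \sum_(j < size (obj t)) f i j * path_coef t j p = path_coef s i p.
Proof.
elim=> {s t f} [t|s t u f g _ [st fE] _ [tu gE]|s t f g _ [st fE] fg gf
  |s s' t t' f g _ [ss' fE] _ [tt' gE]|s t u|t|t].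
- by split=> // i p; apply: (delta_hom_sum (fun j => path_coef t j p)).
- split=> [|i p lis]; first by rewrite st.
  rewrite (comph_sum f g i (fun j => path_coef u j p)) -fE //.
  by apply: eq_bigr => j _; rewrite gE.
- split=> // i p lit; rewrite -[RHS](delta_hom_sum (fun j => path_coef t j p) erefl lit).
  rewrite -/(idh R (obj t)) -gf (comph_sum g f i (fun j => path_coef t j p)).
  by apply: eq_bigr => j _; rewrite fE.
- split=> [|m p lm]; first by rewrite /= ss' tt'.
  have [? ? _ _] := nth_tens lm.
  by rewrite tensh_path_coef // fE // gE // /= ss' tt'.
- by split=> [|m p lm]; [rewrite /= addnA | exact: assoc_path_coef].
- split=> // i p; rewrite /= tens_unitl => lit.
  rewrite (delta_hom_sum (fun j => path_coef t j p)) ?tens_unitl //.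
  rewrite summands_unitl (nth_map 0%N) ?size_iota // nth_iota //=
    add0n fsym_unitl drop0 mulr1.
  by rewrite -path_coef_fusion.
- split=> [|i p]; rewrite /= ?addn0 // tens_unitr => lit.
  rewrite (delta_hom_sum (fun j => path_coef t j p)) ?tens_unitr //.
  rewrite summands_unitr (nth_map 0%N) ?size_iota // nth_iota //=
    add0n tens1r fsym_unitr mulr1.
  by rewrite -path_coef_fusion.
Qed.

(** * Layers in the path basis *)

Definition crossing (s : bool) (u : sym) : C :=
  let t := if s then b else b^-1 in if u is One then t ^+ 2 else t.

(** The action of an elementary piece on functions of paths is the transpose of
    its matrix: to a path [p] at the target it assigns a formal combination of
    paths at the source. In a crossing, alpha brings the two strands together,
    they act through their product [u], and the inverse of alpha separates them.
    A half-circle selects the summand [One] of A (x) A. *)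
Definition elem_terms (a : elem) (p : seq sym) : seq (C * seq sym) :=
  let c := nth One p in
  match a with
  | Arc => [:: (1, p)]
  | EKink s => [:: (if s then b ^- 2 else b ^+ 2, p)]
  | ECross s =>
    [seq (\sum_(u <- [:: One; A]) fsym_inv A A (c 2%N) (c 0%N) v u *
            crossing s u * fsym A A (c 2%N) (c 0%N) u (c 1%N),
          [:: c 0%N, v & drop 2 p]) | v <- [:: One; A]]
  | ELeft => [:: (y * r * fsym A A (c 2%N) (c 0%N) One (c 1%N), drop 2 p)]
  | ERight => [seq (r / y * fsym_inv A A (c 0%N) (c 0%N) v One, [:: c 0%N, v & p])
              | v <- [:: One; A]]
  end.

Definition elem_op (a : elem) (h : seq sym -> C) (p : seq sym) : C :=
  \sum_(t <- elem_terms a p) t.1 * h t.2.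

Definition strands_in (es : seq elem) := sumn [seq nstrands (esrc a) | a <- es].
Definition strands_out (es : seq elem) := sumn [seq nstrands (etgt a) | a <- es].

(** The first [n] entries of [q] followed by [t]; [mkseq] pads with the default
    of [nth], which makes the length of the prefix independent of the size of
    [q] and the lemmas about [splice] unconditional. *)
Definition splice n (q t : seq sym) := mkseq (nth One q) n ++ t.

(** The factors act independently: the first one on the head of the path, the
    others on the part that starts where the strands of the first one end. *)
Fixpoint factors_op (es : seq elem) (h : seq sym -> C) (p : seq sym) : C :=
  if es is a :: es' then
    let n := nstrands (esrc a) in
    elem_op a (fun q => factors_op es' (fun t => h (splice n q t)) (drop n q)) p
  else h p.

Lemma nth_splice n q t m : nth One t 0 = nth One q n -> (m <= n)%N ->
  nth One (splice n q t) m = nth One q m.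
Proof.
move=> tq; rewrite /splice nth_cat size_mkseq leq_eqVlt => /orP[/eqP->|mn].
  by rewrite ltnn subnn.
by rewrite mn nth_mkseq.
Qed.

Lemma drop_splice n m q t : drop (n + m) (splice n q t) = drop m t.
Proof. by rewrite addnC -drop_drop drop_size_cat // size_mkseq. Qed.

Lemma drop_splice0 n q t : drop n (splice n q t) = t.
Proof. by rewrite drop_size_cat // size_mkseq. Qed.

Lemma splice_splice n m q s t :
  splice (n + m) (splice n q s) t = splice n q (splice m s t).
Proof.
rewrite /splice catA; congr (_ ++ _).
rewrite /mkseq iotaD map_cat; congr (_ ++ _).
  apply/eq_in_map => k; rewrite mem_iota add0n => /andP[_ kn].
  by rewrite nth_cat size_map size_iota kn -/(mkseq _ _) nth_mkseq.
rewrite add0n -[in iota n m](addn0 n) iotaDl -map_comp; apply: eq_map => k /=.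
by rewrite nth_cat size_map size_iota ltnNge leq_addr /= addKn.
Qed.

(** A piece preserves the total symbol of its strands and what lies below them:
    these are the only source paths that occur. *)
Lemma elem_op_supp a h h' p :
  (forall q, nth One q 0 = nth One p 0 ->
     drop (nstrands (esrc a)) q = drop (nstrands (etgt a)) p -> h q = h' q) ->
  elem_op a h p = elem_op a h' p.
Proof.
rewrite /elem_op; case: a => [|s|||s] /= hh'; rewrite ?big_cons ?big_nil /=.
- by rewrite hh'.
- by rewrite !hh' //= ?drop0.
- (* A left half-circle has coefficient 0 unless the path returns to the symbol
     from which it started. *)
  case: (eqVneq (nth One p 2) (nth One p 0)) => [p20|].
    by rewrite hh' ?drop0 // nth_drop.
  case: (nth One p 2); case: (nth One p 0) => // _;
    by rewrite /fsym /sixj /= !(mulr0, mul0r).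
- by rewrite !hh' //= ?drop0.
- by rewrite hh'.
Qed.

Lemma elem_op_sum a n (c : 'I_n -> C) h p :
  elem_op a (fun q => \sum_(k < n) c k * h k q) p =
  \sum_(k < n) c k * elem_op a (h k) p.
Proof.
rewrite /elem_op; under [RHS]eq_bigr do rewrite mulr_sumr.
rewrite [RHS]exchange_big /=; apply: eq_bigr => t _; rewrite mulr_sumr.
by apply: eq_bigr => k _; rewrite mulrCA.
Qed.

Lemma factors_op_supp es h h' p :
  (forall q, nth One q 0 = nth One p 0 ->
     drop (strands_in es) q = drop (strands_out es) p -> h q = h' q) ->
  factors_op es h p = factors_op es h' p.
Proof.
elim: es h h' p => [|a es IH] h h' p /= hh'; first by rewrite hh'.
apply: elem_op_supp => q qp qd; apply: IH => t tq td; apply: hh'.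
  by rewrite nth_splice // tq nth_drop addn0.
by rewrite drop_splice td qd drop_drop addnC.
Qed.

Lemma factors_op_sum es n (c : 'I_n -> C) h p :
  factors_op es (fun q => \sum_(k < n) c k * h k q) p =
  \sum_(k < n) c k * factors_op es (h k) p.
Proof.
elim: es h p => //= a es IH h p; rewrite -elem_op_sum.
by apply: elem_op_supp => q _ _; rewrite IH.
Qed.

Lemma factors_op_scale es c h p : factors_op es (fun q => c * h q) p =
  c * factors_op es h p.
Proof.
have := factors_op_sum es (fun=> c) (fun _ : 'I_1 => h) p.
rewrite big_ord1 => <-; apply: factors_op_supp => q _ _; by rewrite big_ord1.
Qed.

Lemma factors_op_cat es es' h p : factors_op (es ++ es') h p =
  factors_op es (fun q => factors_op es' (fun t => h (splice (strands_in es) q t))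
                     (drop (strands_in es) q)) p.
Proof.
elim: es h p => [|a es IH] h p /=; first by rewrite drop0.
apply: elem_op_supp => q _ _; rewrite IH; apply: factors_op_supp => s _ _.
rewrite drop_splice; apply: factors_op_supp => t _ _.
by rewrite splice_splice.
Qed.

Lemma path_coef_local t i p q :
  (forall k, (k <= nstrands t)%N -> nth One p k = nth One q k) ->
  path_coef t i p = path_coef t i q.
Proof.
elim: t i p q => [[|]|l IHl m IHm] i p q pq //=; first by rewrite !pq.
rewrite !pq ?leq_addr // (IHl _ p q) => [|k kl]; last first.
  by rewrite pq // (leq_trans kl) ?leq_addr.
rewrite (IHm _ _ (drop (nstrands l) q)) // => k km.
by rewrite !nth_drop pq //= leq_add2l.
Qed.

Lemma path_coef_pair i p : (i < 2)%N ->
  path_coef (Node (Leaf A) (Leaf A)) i p =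
  fsym A A (nth One p 2) (nth One p 0) (nth One [:: One; A] i) (nth One p 1).
Proof.
case: i => [|[|]] // _; rewrite /= !nth_drop /fsym /sixj /=;
  case: (nth One p 0); case: (nth One p 1); case: (nth One p 2);
  by rewrite /= ?mulr1 ?mulr0 ?mul0r.
Qed.

Lemma emor_path_coef a i p : (i < size (obj (esrc a)))%N ->
  \sum_(j < size (obj (etgt a))) emor P a i j * path_coef (etgt a) j p =
  elem_op a (path_coef (esrc a) i) p.
Proof.
case: a => [|s|||s] iS.
- case: i iS => //= _.
  by rewrite big_ord_recl big_ord0 /elem_op big_cons big_nil /= /mkcoef.
- have {}iS : (i < 2)%N by [].
  change (\sum_(j < 2) emor P (ECross s) i j * path_coef (Node (Leaf A) (Leaf A)) j p =
          elem_op (ECross s) (path_coef (Node (Leaf A) (Leaf A)) i) p).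
  rewrite !big_ord_recl big_ord0 /elem_op !big_cons !big_nil !path_coef_pair //.
  have cE j : (j < 2)%N -> emor P (ECross s) i j =
      (i == j)%:R * crossing s (nth One [:: One; A] i).
    case: i iS => [|[|//]] _; case: j => [|[|//]] _; case: (s);
      by rewrite /crossing /= /mkcoef /= ?mul0r ?mul1r // exprVn.
  rewrite !cE // {cE} /crossing /fsym /fsym_inv.
  set d := 1 / e; set s' := x / r; set q := 1 / (x * r).
  have : q * s' = d by exact: fsym_offdiag.
  have : d * d = 1 - d by exact: fsym_diag_sqr.
  move: d s' q (if s then b else b^-1) => d s' q t dd qs;
  case: i iS => [|[|//]] _; rewrite /= ![nth One (drop 2 p) 0]nth_drop /=;
    case: (nth One p 0); case: (nth One p 1); case: (nth One p 2);
    rewrite /sixj /=; ring: dd qs.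
- case: i iS => // _.
  change (\sum_(j < 2) emor P ELeft 0 j * path_coef (Node (Leaf A) (Leaf A)) j p =
          elem_op ELeft (path_coef (Leaf One) 0) p).
  rewrite !big_ord_recl big_ord0 /elem_op big_cons big_nil !path_coef_pair //.
  by rewrite /= /mkcoef /= mul0r !addr0 mulr1.
- have {}iS : (i < 2)%N by [].
  change (\sum_(j < 1) emor P ERight i j * path_coef (Leaf One) j p =
          elem_op ERight (path_coef (Node (Leaf A) (Leaf A)) i) p).
  rewrite !big_ord_recl big_ord0 /elem_op !big_cons !big_nil !path_coef_pair //.
  rewrite /fsym /fsym_inv; set d := 1 / e; set s' := x / r; set q := 1 / (x * r).
  have : q * s' = d by exact: fsym_offdiag.
  have : d * d = 1 - d by exact: fsym_diag_sqr.
  have -> : emor P ERight i 0 = (i == 0%N)%:R * (r / y).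
    by case: i iS => [|[|//]] _; rewrite /= /mkcoef /= ?mul1r ?mul0r.
  move: d s' q (r / y) => d s' q z dd qs.
  case: i iS => [|[|//]] _; rewrite /=;
    case: (nth One p 0); rewrite /sixj /=; ring: dd qs.
- case: i iS => // _; rewrite /= big_ord_recl big_ord0 /elem_op big_cons big_nil /=.
  by rewrite !addr0; case: s; rewrite /= /mkcoef /= /mkcoef /= mulr1.
Qed.

Lemma strands_in_leaves T : strands_in (leaves T) = nstrands (tsrc T).
Proof.
elim: T => [a|l IHl m IHm] /=; first by rewrite /strands_in /= addn0.
by rewrite /strands_in map_cat sumn_cat -IHl -IHm.
Qed.

Lemma strands_out_leaves T : strands_out (leaves T) = nstrands (ttgt T).
Proof.
elim: T => [a|l IHl m IHm] /=; first by rewrite /strands_out /= addn0.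
by rewrite /strands_out map_cat sumn_cat -IHl -IHm.
Qed.

(** The right-hand side depends on [T] through its leaves only: this is the
    independence of the bracketing of a layer. *)
Lemma mu_path_coef T i p : (i < size (obj (tsrc T)))%N ->
  \sum_(j < size (obj (ttgt T))) mu P T i j * path_coef (ttgt T) j p =
  factors_op (leaves T) (path_coef (tsrc T) i) p.
Proof.
elim: T i p => [a|l IHl m IHm] i p iT.
  rewrite emor_path_coef //=; apply: elem_op_supp => q _ _.
  apply: path_coef_local => k kn.
  by rewrite nth_splice // nth_drop addn0.
have [il im _ _] := nth_tens iT.
rewrite [leaves _]/= factors_op_cat (tensh_path_coef (mu P l) (mu P m)) // IHl // IHm //.
rewrite strands_in_leaves /=; set n := nth 0t _ i.
set Fi := fsym _ _ _ _ _ _; rewrite [RHS](_ : _ = factors_op (leaves l) (fun q =>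
  (Fi * factors_op (leaves m) (path_coef (tsrc m) n.1.2)
          (drop (nstrands (ttgt l)) p)) * path_coef (tsrc l) n.1.1 q) p).
  by rewrite factors_op_scale mulrAC.
apply: factors_op_supp => q qp; rewrite strands_in_leaves strands_out_leaves => qd.
rewrite -qd mulrAC -factors_op_scale; apply: factors_op_supp => t tq.
rewrite strands_in_leaves strands_out_leaves => td.
(* In the path that is q above and t below, the three symbols entering the
   6j-symbol of the node are those of p. *)
have tq' : nth One t 0 = nth One q (nstrands (tsrc l)) by rewrite tq nth_drop addn0.
have s0 : nth One (splice (nstrands (tsrc l)) q t) 0 = nth One p 0.
  by rewrite nth_splice.
have s1 : nth One (splice (nstrands (tsrc l)) q t) (nstrands (tsrc l))
          = nth One p (nstrands (ttgt l)).
  by rewrite nth_splice // -[nstrands (tsrc l)]addn0 -nth_drop qd nth_drop addn0.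
have s2 : nth One (splice (nstrands (tsrc l)) q t)
            (nstrands (tsrc l) + nstrands (tsrc m))
          = nth One p (nstrands (ttgt l) + nstrands (ttgt m)).
  rewrite -nth_drop drop_splice0 -[nstrands (tsrc m)]addn0 -nth_drop td.
  by rewrite qd drop_drop nth_drop addn0 addnC.
rewrite -/n drop_splice0 s0 s1 s2 -/Fi; congr (_ * _ * _).
by apply: path_coef_local => k kn; rewrite nth_splice.
Qed.

(** * Composite morphisms *)

(** As the action is by transposes, the layers are applied from left to right. *)
Fixpoint diagram_op (D : seq layer) (h : seq sym -> C) (p : seq sym) : C :=
  if D is l :: D' then diagram_op D' (factors_op (factors l) h) p else h p.

Lemma eq_diagram_op D h h' p : h =1 h' -> diagram_op D h p = diagram_op D h' p.
Proof.
elim: D h h' => [|l D IH] h h' hh' /=; first exact: hh'.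
by apply: IH => q; apply: factors_op_supp.
Qed.

Lemma diagram_op_sum D n (c : 'I_n -> C) h p :
  diagram_op D (fun q => \sum_(k < n) c k * h k q) p =
  \sum_(k < n) c k * diagram_op D (h k) p.
Proof.
elim: D h p => //= l D IH h p; rewrite -IH; apply: eq_diagram_op => q.
exact: factors_op_sum.
Qed.

Lemma diagram_op_cat D D' h p : diagram_op (D ++ D') h p =
  diagram_op D' (diagram_op D h) p.
Proof. by elim: D h => [|l D IH] h /=. Qed.

Lemma composite_path_coef D s t (f : hom (obj s) (obj t)) : composite P D f ->
  forall i p, (i < size (obj s))%N ->
  \sum_(j < size (obj t)) f i j * path_coef t j p = diagram_op D (path_coef s i) p.
Proof.
elim=> {D s t f} [l T lT|l T D s t tau f lT tauP _ fE] i p iT.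
  by rewrite mu_path_coef // lT.
rewrite (comph_sum _ f i (fun j => path_coef t j p)).
under eq_bigr => k _ do rewrite fE //.
rewrite -diagram_op_sum; apply: eq_diagram_op => q.
rewrite (comph_sum (mu P T) tau i (fun j => path_coef s j q)) -lT -mu_path_coef //.
by apply: eq_bigr => k _; rewrite (reassoc_path_coef tauP).2.
Qed.

(** On the empty bracketing the path coefficient is 1, and [:: One] is the only
    path from 1 to 1 without strands. *)
Lemma composite_value D (f : hom (obj (Leaf One)) (obj (Leaf One))) :
  composite P D f ->
  f 0%N 0%N = diagram_op D (fun=> 1) [:: One].
Proof.
move=> /(@composite_path_coef D (Leaf One) (Leaf One) f)/(_ 0%N [:: One] isT).
by rewrite big_ord_recl big_ord0 /= addr0 mulr1.
Qed.

(** * The quadratic equation of beta *)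

Lemma cis_sqr (t : R) : cis t ^+ 2 = (2%:R * cos t)%:C * cis t - 1.
Proof.
rewrite /cis; apply/eqP; rewrite eq_complex /=; apply/andP; split; apply/eqP.
  have := cos2Dsin2 t; nra.
nra.
Qed.

(** The angle t = pi / 5 satisfies 3 t = pi - 2 t, so cos (3 t) = - cos (2 t);
    in terms of c = cos t this is (c + 1) (4 c^2 - 2 c - 1) = 0. *)
Lemma cos_pi5 (c := cos (pi / 5%:R) : R) :
  [/\ 0 < c, 4%:R * c ^+ 2 = 2%:R * c + 1
    & 2%:R * cos (3%:R * pi / 5%:R) = 1 - 2%:R * c].
Proof.
have pi0 := pi_gt0 R.
have c0 : 0 < c by apply: cos_gt0_pihalf; apply/andP; split; lra.
have c2 : cos (2%:R * pi / 5%:R) = 2%:R * c ^+ 2 - 1 :> R.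
  have -> : 2%:R * pi / 5%:R = (pi / 5%:R) *+ 2 :> R by rewrite mulr2n; field.
  by rewrite cos_mulr2n mulr_natl.
have c3 : cos (3%:R * pi / 5%:R) = 1 - 2%:R * c ^+ 2 :> R.
  have -> : 3%:R * pi / 5%:R = pi - 2%:R * pi / 5%:R :> R by field.
  by rewrite cosB cospi sinpi mul0r addr0 c2; ring.
have cE : 4%:R * c ^+ 2 = 2%:R * c + 1.
  have c3' : cos (3%:R * pi / 5%:R) = 4%:R * c ^+ 3 - 3%:R * c :> R.
    have -> : 3%:R * pi / 5%:R = (pi / 5%:R) *+ 2 + pi / 5%:R :> R.
      by rewrite mulr2n; field.
    rewrite cosD cos_mulr2n sin_mulr2n -/c.
    have := cos2Dsin2 (pi / 5%:R : R); rewrite -/c => cs.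
    set s := sin _ in cs *.
    have ss : s ^+ 2 = 1 - c ^+ 2 by rewrite -cs addrC addKr.
    by ring: ss.
  have /eqP : (c + 1) * (4%:R * c ^+ 2 - 2%:R * c - 1) = 0.
    move: c3'; rewrite c3 => h.
    transitivity (4%:R * c ^+ 3 - 3%:R * c - (1 - 2%:R * c ^+ 2)); first by ring.
    by rewrite h subrr.
  rewrite mulf_eq0 => /orP[/eqP|/eqP]; lra.
by split=> //; rewrite c3; lra.
Qed.

Lemma golden_uniq (t u : R) : 0 < t -> 0 < u -> t ^+ 2 = t + 1 -> u ^+ 2 = u + 1 -> t = u.
Proof.
move=> t0 u0 tt uu; have /eqP : (t - u) * (t + u - 1) = 0.
  by transitivity (t ^+ 2 - t - (u ^+ 2 - u)); [ring | rewrite tt uu; ring].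
by rewrite mulf_eq0 => /orP[/eqP|/eqP]; nra.
Qed.

(** This says beta + 1 / beta = 1 - eps. Indeed 2 cos (pi / 5) is the positive
    root of t^2 = t + 1, hence equal to eps or to 1 - eps according to the sign
    of eps, and 2 cos (3 pi / 5) = 1 - 2 cos (pi / 5). *)
Lemma beta_quadratic : b ^+ 2 = (1 - e) * b - 1.
Proof.
suff [t tE ->] : exists2 t : R, 2%:R * cos t = 1 - eps P & b = cis t.
  by rewrite cis_sqr tE rmorphB.
have [c0 cE c3] := cos_pi5; set c := cos _ in c0 cE c3.
have cc : (2%:R * c) ^+ 2 = 2%:R * c + 1 by nra.
have c20 : 0 < 2%:R * c by lra.
have ee := eps_eq P.
have [e0|e0|e0] := ltrgtP 0 (eps P).
- have eE := golden_uniq e0 c20 ee cc.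
  by case: (beta_pos e0) => ->;
    [exists (3%:R * pi / 5%:R) | exists (- (3%:R * pi / 5%:R))]; rewrite ?cosN // c3 eE.
- have eE : 1 - eps P = 2%:R * c by apply: golden_uniq => //; nra.
  by case: (beta_neg e0) => ->; [exists (pi / 5%:R) | exists (- (pi / 5%:R))];
    rewrite ?cosN // eE.
- by move: ee; rewrite -e0 expr0n /= add0r => /eqP; rewrite eq_sym oner_eq0.
Qed.

(** * The value of a clasp *)

(** In the middle of a clasp there are four strands with total symbol 1, and the
    first and the last one are single strands from 1 to [A]; the only freedom is
    the symbol [v] in between. *)
Lemma op_open v h : factors_op [:: Arc; ELeft; Arc] h [:: One; A; v; A; One] =
  y * r * fsym A A A A One v * h [:: One; A; One].
Proof.
by case: v; rewrite /= /elem_op /= !(big_cons, big_nil) /= !(mul1r, addr0).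
Qed.

Lemma op_close h : factors_op [:: Arc; ERight; Arc] h [:: One; A; One] =
  r / y * fsym_inv A A A A One One * h [:: One; A; One; A; One] +
  r / y * fsym_inv A A A A A One * h [:: One; A; A; A; One].
Proof.
by rewrite /= /elem_op /= !(big_cons, big_nil) /= !(mul1r, addr0).
Qed.

(** As the path starts or ends at [One] next to the crossing, the product of the
    two crossing strands is [v], so the crossing is diagonal. *)
Lemma op_cross_top s v h :
  factors_op [:: ECross s; Arc; Arc] h [:: One; A; v; A; One] =
  crossing s v * h [:: One; A; v; A; One].
Proof.
case: v; rewrite /= /elem_op /= !(big_cons, big_nil) /=;
by rewrite /fsym_inv /fsym /sixj /= !(mul1r, mulr1, addr0, mul0r, mulr0, add0r).
Qed.

Lemma op_cross_bottom s v h :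
  factors_op [:: Arc; Arc; ECross s] h [:: One; A; v; A; One] =
  crossing s v * h [:: One; A; v; A; One].
Proof.
case: v; rewrite /= /elem_op /= !(big_cons, big_nil) /=;
by rewrite /fsym_inv /fsym /sixj /= !(mul1r, mulr1, addr0, mul0r, mulr0, add0r).
Qed.

Lemma clasp_value s i h :
  diagram_op (clasp s i) h [:: One; A; One] = - e^-1 * h [:: One; A; One].
Proof.
change (factors_op [:: Arc; ERight; Arc] (factors_op [:: Arc; Arc; ECross s]
  (factors_op [:: ECross s; Arc; Arc] (factors_op [:: Arc; ELeft; Arc] h)))
  [:: One; A; One]
  = - e^-1 * h [:: One; A; One]).
rewrite op_close !op_cross_bottom !op_cross_top !op_open !mulrA -mulrDl.
congr (_ * _).
rewrite /fsym_inv /fsym /sixj /crossing /=.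
have y0 := py_neq0 P; have x0 := px_neq0 P; have r0 := sqrteps_neq0.
have e0 := eps_neq0.
have b0 : b != 0.
  apply/eqP => b0; move/eqP: beta_quadratic.
  by rewrite b0 expr0n mulr0 add0r eq_sym oppr_eq0 oner_eq0.
have : (if s then b else b^-1) ^+ 2 = (1 - e) * (if s then b else b^-1) - 1.
  case: (s); first exact: beta_quadratic.
  apply: (mulfI (expf_neq0 2 b0)).
  rewrite -exprMn divff // expr1n.
  transitivity ((1 - e) * b - b ^+ 2); last by field.
  by rewrite beta_quadratic opprB addrC subrK.
move: (if s then b else b^-1) => t tt.
(* Both signs of the clasp give the same equation for t, as the equation of
   beta is invariant under inversion. *)
have key : t ^+ 4 + e * t ^+ 2 = -1 by ring: tt eps_sqr.
transitivity (e^-1 * (t ^+ 4 + e * t ^+ 2)); last by rewrite key mulrN1.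
rewrite -!sqrteps_sqr; field.
by rewrite r0 x0 y0.
Qed.

(** * The chain *)

Lemma hopf_value n s :
  diagram_op (hopf_layers n.+1 s) (fun=> 1) [:: One] = e * (- e^-1) ^+ n.
Proof.
rewrite /hopf_layers -cat1s !diagram_op_cat.
set h0 := diagram_op [:: Layer [::] (LHalf (0%N, true)) [::]] _.
have h0E : h0 [:: One; A; One] = y * r.
  by rewrite /h0 /= /elem_op /= !(big_cons, big_nil) /= /fsym /sixj /= addr0 !mulr1.
have clasps i m h :
    diagram_op (flatten [seq clasp (s j) j | j <- iota i m]) h [:: One; A; One] =
    (- e^-1) ^+ m * h [:: One; A; One].
  elim: m i h => [|m IH] i h; first by rewrite /= mul1r.
  rewrite [flatten _](_ : _ = clasp (s i) i ++
    flatten [seq clasp (s j) j | j <- iota i.+1 m]) //.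
  by rewrite diagram_op_cat IH clasp_value mulrA exprSr.
set h1 := diagram_op (flatten _) h0.
have -> : diagram_op [:: Layer [::] (RHalf (n, true)) [::]] h1 [:: One] =
    r / y * h1 [:: One; A; One].
  rewrite /= /elem_op /= !(big_cons, big_nil) /=.
  by rewrite /fsym_inv /sixj /= !(mulr1, mulr0, mul0r, add0r, addr0).
rewrite /h1 clasps h0E.
have y0 := py_neq0 P; rewrite -sqrteps_sqr; field; exact: y0.
Qed.

Lemma hom_eq X Y (f g : hom X Y) : coef f =2 coef g -> f = g.
Proof.
case: f g => [f fP] [g gP] /= fg.
have E : f = g by apply: funext => i; apply: funext => j.
by move: fP; rewrite E => fP; rewrite (Prop_irrelevance fP gP).
Qed.

(** * Existence of bracketings *)

Definition rebracket (s t : btree sym) : Prop :=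
  exists f : hom (obj s) (obj t), reassoc P f.

Lemma rebracket_refl t : rebracket t t.
Proof. by exists (idh R (obj t)); exact: Rid. Qed.

Lemma rebracket_trans s t u : rebracket s t -> rebracket t u -> rebracket s u.
Proof. by move=> [f fP] [g gP]; exists (comph f g); exact: Rcomp fP gP. Qed.

Lemma rebracket_node s s' t t' :
  rebracket s s' -> rebracket t t' -> rebracket (Node s t) (Node s' t').
Proof. by move=> [f fP] [g gP]; exists (tensh f g); exact: Rtens. Qed.

Lemma rebracket_assoc s t u :
  rebracket (Node (Node s t) u) (Node s (Node t u)).
Proof. by exists (assoc P (obj s) (obj t) (obj u)); exact: Rassoc. Qed.

Lemma rebracket_unitl t : rebracket (Node (Leaf One) t) t.
Proof. by eexists; exact: Runitl. Qed.

Local Notation a := (Leaf A).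

(** A (x) 1 computes to the tuple A, so the unit isomorphism is given by an
    identity matrix and is its own inverse. *)
Lemma rebracket_unitr_inv : rebracket a (Node a (Leaf One)).
Proof.
have E : comph (idh R [:: A]) (idh R [:: A]) = idh R [:: A].
  apply: hom_eq => i j; rewrite comphE big_ord_recl big_ord0 addr0.
  case: i => [|i]; case: j => [|j]; rewrite /= /mkcoef /= ?andbF ?mul0r ?mulr0 ?mulr1 //.
by exists (idh R [:: A]); apply: (Rinv (Runitr P a)).
Qed.

(** Source and target of alpha on A, A, A compute to the same tuple, which makes
    it meaningful to compose alpha with itself. *)
Lemma assoc_involutive (f := assoc P [:: A] [:: A] [:: A]
    : hom [:: A; One; A] [:: A; One; A]) : comph f f = idh R [:: A; One; A].
Proof.
apply: hom_eq => i j; rewrite comphE !big_ord_recl big_ord0 addr0.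
have := fsym_diag_sqr; have := fsym_offdiag.
case: i => [|[|[|i]]]; case: j => [|[|[|j]]]; 
  rewrite /= /mkcoef /= /mkcoef /= ?andbF ?(mul0r, mulr0) ?addr0 //.
all: rewrite ?(mul0r, mulr0, add0r, addr0, mulr1) // => qs pp.
- by rewrite qs pp subrK.
- by ring.
- by ring.
- by rewrite mulrNN pp mulrC qs addrC subrK.
Qed.

Lemma rebracket_assoc_inv : rebracket (Node a (Node a a)) (Node (Node a a) a).
Proof.
exists (assoc P [:: A] [:: A] [:: A] : hom [:: A; One; A] [:: A; One; A]).
apply: (Rinv (Rassoc P a a a)); exact: assoc_involutive.
Qed.

Lemma composite_cons l T D s t : leaves T = factors l -> rebracket (ttgt T) s ->
  (exists f : hom (obj s) (obj t), composite P D f) ->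
  exists f : hom (obj (tsrc T)) (obj t), composite P (l :: D) f.
Proof. by move=> lT [tau tauP] [f fP]; eexists; apply: (Ccons lT tauP fP). Qed.

(** The bracketings of the layers of a clasp are, for strands a b c d,
    ((a b) c) d at the left half-circle and at the upper crossing, (a b) (c d) at
    the lower crossing and a ((b c) d) at the right half-circle. They are chosen
    so that every crossing or half-circle joins sibling leaves and only alpha on
    three single strands has to be inverted. *)
Lemma hopf_tail m i s : exists2 u : btree sym, rebracket (Node a a) u &
  exists f : hom (obj u) (obj (Leaf One)),
    composite P (flatten [seq clasp (s j) j | j <- iota i m]
      ++ [:: Layer [::] (RHalf ((i + m)%N, true)) [::]]) f.
Proof.
elim: m i => [|m IH] i.
  exists (Node a a); first exact: rebracket_refl.
  by exists (mu P (Leaf ERight)); apply: (Clast P (T := Leaf ERight)).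
have [u uP fP] := IH i.+1; rewrite addSnnS in fP.
have aR := rebracket_refl a.
exists (Node (Node a (Leaf One)) a).
  exact: rebracket_node rebracket_unitr_inv aR.
apply: (composite_cons (T := Node (Node (Leaf Arc) (Leaf ELeft)) (Leaf Arc))
  (s := Node (Node (Node a a) a) a)) => //.
  exact: rebracket_node rebracket_assoc_inv aR.
apply: (composite_cons (T := Node (Node (Leaf (ECross (s i))) (Leaf Arc)) (Leaf Arc))
  (s := Node (Node a a) (Node a a))) => //; first exact: rebracket_assoc.
apply: (composite_cons (T := Node (Node (Leaf Arc) (Leaf Arc)) (Leaf (ECross (s i))))
  (s := Node a (Node (Node a a) a))) => //.
  exact: rebracket_trans (rebracket_assoc _ _ _) (rebracket_node aR rebracket_assoc_inv).
apply: (composite_cons (T := Node (Leaf Arc) (Node (Leaf ERight) (Leaf Arc)))) fP => //.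
exact: rebracket_trans (rebracket_node aR (rebracket_unitl _)) uP.
Qed.

Lemma hopf_composite n s :
  exists f : hom (obj (Leaf One)) (obj (Leaf One)),
    composite P (hopf_layers n.+1 s) f.
Proof.
have [u uP fP] := hopf_tail n 0 s.
exact: (composite_cons (T := Leaf ELeft)) uP fP.
Qed.

(** * The invariant of the chain *)

Lemma delete_constA D : delete (fun=> A) D = D.
Proof.
elim: D => [|[u p w] D IH] //.
rewrite -[in RHS]IH /delete /= (_ : keep_piece _ p = true); last by case: p.
by rewrite /= !filter_predT.
Qed.

Lemma writhe_hopf n s : writhe (hopf_chain n.+1 s) = 0.
Proof.
rewrite /writhe big1_seq // => i _; rewrite /writhe1 /= big_cons big_cat big_flatten /=.
rewrite big_map big_cons big_nil big1 //= => j _.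
rewrite /clasp !big_cons big_nil /=.
by case: (eqVneq j i) => [<-|_] /=; rewrite ?(gtn_eqF (ltnSn _)) ?andbF ?addr0.
Qed.

Lemma evaluates_hopf n s v : evaluates P (hopf_chain n.+1 s) (fun=> A) v <->
  v = e * (- e^-1) ^+ n.
Proof.
rewrite /evaluates delete_constA /= -(hopf_value n s); split=> [[f [fP ->]]|->].
  exact: composite_value.
have [f fP] := hopf_composite n s; exists f; split=> //.
by rewrite (composite_value fP).
Qed.

End Paths.
Unset Implicit Arguments.

Theorem theorem7 (R : realType) (P : params R) (k : nat) (hk : (1 <= k)%N)
    (s : nat -> bool) (v : R[i]) :
  is_tr P (hopf_chain k s) v <->
  v = (-1) ^+ (k - 1) * (eps P)%:C ^ (1 - k%:Z).
Proof.
case: k hk => [|n] // _.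
have e0 := eps_neq0 P.
rewrite /is_tr writhe_hopf mulr0 expr0z subn1.
have -> : (1 - n.+1%:Z) = - n%:Z by rewrite intS opprD addrA subrr add0r.
have -> : (-1) ^+ n.+1.-1 * (eps P)%:C ^ (- n%:Z) =
    1 / (eps P)%:C * ((eps P)%:C * (- ((eps P)%:C)^-1) ^+ n).
  by rewrite mulrA div1r mulVf // mul1r (exprNn _^-1) exprVn exprnN.
split=> [[z /evaluates_hopf -> ->]|->] //.
by exists ((eps P)%:C * (- ((eps P)%:C)^-1) ^+ n); rewrite ?evaluates_hopf.
Qed.
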